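(* Let $p$ be a prime, $N\ge 1$ an integer, $K$ an unramified extension of $\mathbb{Q}_p$ such that the equation $\omega^{p^N}=\omega$ has exactly $p^N$ solutions in $K$, and $A$ a commutative ultrametric $K$-Banach algebra with unit whose norm satisfies $|A|=|K|$. (i) If $x\in A$ is a $p$-adic Hermite operator with period $1$, then there exists a finitely additive, orthogonal-projection-valued spectral measure $E$ over $\mathbb{Q}_p$ with values in $A$ such that $$I=\int_{\mathbb{Q}_p}dE_\lambda,\qquad x=\int_{\mathbb{Q}_p}\lambda\,dE_\lambda .$$ (ii) If $x\in A$ is a $p$-adic Hermite operator with period $N$, then there exists a finitely additive, orthogonal-projection-valued spectral measure $E$ over $K$ with values in $A$ such that $$I=\int_{K}dE_\lambda,\qquad x=\int_{K}\lambda\,dE_\lambda .$$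
   Context: $K$ carries the unique multiplicative norm extending the $p$-adic norm, with $|p|=1/p$. The norm of $A$ is non-Archimedean ($|a+b|\le\max(|a|,|b|)$) and submultiplicative, $|1|=1$, and $|A|=|K|$ means that the norm takes the same set of values on $A$ as on $K$. $I=1$ is the unit of $A$ and $A_0=\{a\in A: |a|\le 1\}$. $T_N(A_0)=\{a\in A_0: a^{p^N}=a\}$. An element $x\in A$ is a $p$-adic Hermite operator with period $N$ if there are $k\in\mathbb{Z}$ and elements $x_i\in T_N(A_0)$ ($i\ge k$) with $x=\sum_{i=k}^{\infty}x_ip^i$ (convergent in norm). An orthogonal projection in $A$ is an element $\pi$ with $\pi^2=\pi$ and $|\pi|=1$; the zero projection is also allowed as a value of a measure. Let $F$ be $\mathbb{Q}_p$ or $K$. A finitely additive orthogonal-projection-valued spectral measure over $F$ is a map $E$ from the Boolean algebra of subsets of $F$ generated by the balls $\{\lambda:|\lambda-c|\le p^{-n}\}$ ($c\in F$, $n\in\mathbb{Z}$) to the set of orthogonal projections of $A$ (including $0$), such that $E(U\sqcup V)=E(U)+E(V)$ for disjoint $U,V$ and $E(U)E(V)=0$ for disjoint $U,V$. The integrals mean the following: for every $n$ only finitely many balls $B$ of radius $p^{-n}$ in $F$ satisfy $E(B)\neq 0$; $I=\int_F dE_\lambda$ means $\sum_B E(B)=I$ for every $n$, the sum being over balls of radius $p^{-n}$; and $x=\int_F\lambda\,dE_\lambda$ means $x=\lim_{n\to\infty}\sum_B\lambda_B E(B)$ in norm, the sum being over balls of radius $p^{-n}$, with $\lambda_B\in B$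 arbitrary. *)

(* Defs.v *)
From HB Require Import structures.
From mathcomp Require Import all_boot all_order all_algebra.
From mathcomp Require Import all_classical all_reals all_analysis.

Set Implicit Arguments.
Unset Strict Implicit.
Unset Printing Implicit Defensive.

Import Order.TTheory GRing.Theory Num.Theory.
Import numFieldNormedType.Exports.

Local Open Scope classical_set_scope.
Local Open Scope ring_scope.

(* Norms are plain functions into a realType, and not MathComp's normedZmodType
   norms: the latter satisfy |x *+ n| = |x| *+ n, which no non-Archimedean norm
   on a nonzero space does. *)

Section Norms.
Context {R : realType}.

Definition norm_cvg (V : zmodType) (v : V -> R) (u : nat -> V) (l : V) : Prop :=
  (fun n => v (u n - l)) @ \oo --> (0 : R).

Definition norm_cauchy (V : zmodType) (v : V -> R) (u : nat -> V) : Prop :=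
  forall e : R, 0 < e ->
    exists n0 : nat, forall m n : nat,
      (n0 <= m)%N -> (n0 <= n)%N -> v (u m - u n) < e.

Definition norm_complete (V : zmodType) (v : V -> R) : Prop :=
  forall u : nat -> V, norm_cauchy v u -> exists l : V, norm_cvg v u l.

Record ultrametric_absval (F : fieldType) (v : F -> R) : Prop := {
  absval_ge0 : forall x, 0 <= v x;
  absval_eq0 : forall x, v x = 0 <-> x = 0;
  absvalM : forall x y, v (x * y) = v x * v y;
  absvalD : forall x y, v (x + y) <= Num.max (v x) (v y)
}.

Record ultrametric_banach_algebra (K : fieldType) (nK : K -> R)
    (A : comAlgType K) (nA : A -> R) : Prop := {
  banach_ge0 : forall a, 0 <= nA a;
  banach_eq0 : forall a, nA a = 0 <-> a = 0;
  banachZ : forall (c : K) a, nA (c *: a) = nK c * nA a;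
  banachD : forall a b, nA (a + b) <= Num.max (nA a) (nA b);
  banachM : forall a b, nA (a * b) <= nA a * nA b;
  banach1 : nA 1 = 1;
  banach_complete : norm_complete nA
}.

End Norms.

Section PadicFields.
Context {R : realType}.

Definition padic_absval (p : nat) (q : rat) : R :=
  if q == 0 then 0
  else (p%:R : R) ^ ((logn p `|denq q|)%:Z - (logn p `|numq q|)%:Z).

(* (Qp, v) is the field of p-adic numbers: a completion of the rationals for
   the p-adic absolute value, which determines it up to a unique isometric
   isomorphism. *)
Record padic_numbers (p : nat) (Qp : fieldType) (v : Qp -> R) : Prop := {
  padic_ultrametric : ultrametric_absval v;
  padic_rat : forall q : rat, v (ratr q) = padic_absval p q;
  padic_dense : forall (x : Qp) (e : R), 0 < e ->
    exists q : rat, v (x - ratr q) < e;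
  padic_is_complete : norm_complete v
}.

(* An algebraic extension iota : Qp -> K with ramification index 1 (same value
   set) and separable residue extension: unram_residue says that each residue
   class is a simple root of the reduction of a polynomial over the ring of
   integers of Qp.  (This clause always holds, the residue field of Qp being
   the perfect field with p elements.)  The multiplicative norm on K extending
   that of Qp is unique because K is algebraic over Qp. *)
Record unramified_extension (Qp : fieldType) (nQ : Qp -> R)
    (K : fieldType) (nK : K -> R) (iota : {rmorphism Qp -> K}) : Prop := {
  unram_algebraic : forall x : K, algebraicOver iota x;
  unram_ultrametric : ultrametric_absval nK;
  unram_extends : forall y : Qp, nK (iota y) = nQ y;
  unram_values : range nK = range nQ;
  unram_residue : forall x : K, nK x <= 1 ->
    exists f : {poly Qp},
      [/\ forall i, nQ f`_i <= 1,
          nK (map_poly iota f).[x] < 1 &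
          nK (map_poly iota f^`()).[x] = 1]
}.

End PadicFields.

Section Hermite.
Context {R : realType} (p : nat) {K : fieldType} {A : comAlgType K}.
Variable nA : A -> R.

Definition teichmuller_set (N : nat) : set A :=
  [set a | nA a <= 1 /\ a ^+ (p ^ N) = a].

Definition padic_hermite (N : nat) (x : A) : Prop :=
  exists (k : int) (xs : int -> A),
    (forall i : int, k <= i -> teichmuller_set N (xs i)) /\
    norm_cvg nA
      (fun n => \sum_(0 <= j < n) (p%:R : K) ^ (k + j%:Z) *: xs (k + j%:Z)) x.

Definition orthogonal_projection (e : A) : Prop := e * e = e /\ nA e = 1.

End Hermite.

Section SpectralMeasure.
Context {R : realType} (p : nat) {F : fieldType}.
Variable nF : F -> R.

Definition pball (n : int) (c : F) : set F :=
  [set l | nF (l - c) <= (p%:R : R) ^ (- n)].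

Definition pballs (n : int) : set (set F) := range (pball n).

Definition set_algebra (G : set (set F)) : Prop :=
  [/\ G set0, setC_closed G & setU_closed G].

Definition ball_algebra : set (set F) :=
  smallest set_algebra (\bigcup_n pballs n).

Context {K : fieldType} {A : comAlgType K}.
Variable nA : A -> R.

(* Only the values of E on ball_algebra are meaningful. *)
Record spectral_measure (E : set F -> A) : Prop := {
  spectral_proj : forall U, ball_algebra U ->
    E U = 0 \/ orthogonal_projection nA (E U);
  spectral_add : forall U V, ball_algebra U -> ball_algebra V ->
    U `&` V = set0 -> E (U `|` V) = E U + E V;
  spectral_orth : forall U V, ball_algebra U -> ball_algebra V ->
    U `&` V = set0 -> E U * E V = 0
}.

Definition finitely_many_balls (E : set F -> A) : Prop :=
  forall n : int, finite_set [set B | pballs n B /\ E B != 0].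

(* a is the integral of dE over F *)
Definition spectral_integral_one (E : set F -> A) (a : A) : Prop :=
  finitely_many_balls E /\ forall n : int, \sum_(B \in pballs n) E B = a.

(* x is the integral of lambda dE_lambda over F, where the scalar lambda in F
   acts on A through j : F -> K; lam n B is the sample point chosen in the ball
   B of radius p ^ (- n). *)
Definition spectral_integral_id (j : F -> K) (E : set F -> A) (x : A) : Prop :=
  finitely_many_balls E /\
  forall lam : nat -> set F -> F,
    (forall (n : nat) B, pballs n%:Z B -> B (lam n B)) ->
    norm_cvg nA (fun n => \sum_(B \in pballs n%:Z) j (lam n B) *: E B) x.

End SpectralMeasure.

(* Main.v *)
(** Let [q = p ^ N] and let [T] be the [q] roots of [w ^+ q = w] in the scalar
    field.  They are at mutual distance 1, so each digit [x_i] of [x] (a root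
    of [X ^+ q - X] in the unit ball of [A]) decomposes by Lagrange
    interpolation as [\sum_(w in T) w e_(i,w)], where the [e_(i,w)] are
    orthogonal idempotents of norm at most 1 with sum 1.  Products of these
    idempotents over words of digits give multiplicative functionals
    [f |-> \sum_w (\prod_i e_(i,w_i)) f (\sum_i w_i p ^ (k + i))], and
    [E U] is the eventual value of these functionals on the indicator of [U].
    Over the p-adic numbers the [p] roots of [w ^+ p = w] are obtained as the
    limits of [a ^+ (p ^ n)] for [0 <= a < p]. *)
Require Import Defs.
From mathcomp Require Import all_boot all_order all_algebra.
From mathcomp Require Import all_classical all_reals all_analysis.

Import Order.TTheory GRing.Theory Num.Theory.
Import numFieldNormedType.Exports.
Local Open Scope classical_set_scope.
Local Open Scope card_scope.
Local Open Scope ring_scope.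

(** * Ultrametric estimates in abelian groups *)

Section UltrametricNorm.
Set Implicit Arguments.
Unset Strict Implicit.
Context {R : realType}.

(** Isolates what absolute values on fields and the norm of [A] have in common, so that the same
    estimates serve both. *)
Record ultrametric_norm (V : zmodType) (v : V -> R) : Prop := {
  ultra0 : v 0 = 0;
  ultraN : forall x, v (- x) = v x;
  ultraD : forall x y, v (x + y) <= Num.max (v x) (v y)
}.

Context {V : zmodType} {v : V -> R} (hv : ultrametric_norm v).

Lemma ultra_leD c x y : v x <= c -> v y <= c -> v (x + y) <= c.
Proof. by move=> vx vy; rewrite (le_trans (ultraD hv x y))// ge_max vx. Qed.

Lemma ultra_leB c x y : v x <= c -> v y <= c -> v (x - y) <= c.
Proof. by move=> vx vy; rewrite ultra_leD ?(ultraN hv). Qed.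

Lemma ultra_subC x y : v (x - y) = v (y - x).
Proof. by rewrite -(ultraN hv) opprB. Qed.

Lemma ultra_ltD c x y : v x < c -> v y < c -> v (x + y) < c.
Proof. by move=> vx vy; rewrite (le_lt_trans (ultraD hv x y))// gt_max vx. Qed.

Lemma ultra_le_sum (I : eqType) (s : seq I) (f : I -> V) c :
  0 <= c -> {in s, forall i, v (f i) <= c} -> v (\sum_(i <- s) f i) <= c.
Proof.
move=> c0 hf; rewrite big_seq; elim/big_rec: _ => [|i x si vx].
  by rewrite (ultra0 hv).
by rewrite ultra_leD// hf.
Qed.

End UltrametricNorm.

(** * Absolute values: power maps, separation of roots, Teichmüller lifting *)

Section AbsoluteValue.
Set Implicit Arguments.
Unset Strict Implicit.
Context {R : realType} {F : fieldType} {v : F -> R}.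
Hypothesis hv : ultrametric_absval v.

Lemma absval0 : v 0 = 0.
Proof. exact/(absval_eq0 hv). Qed.

Lemma absval1 : v 1 = 1.
Proof.
have v1 : v 1 != 0 by apply/eqP => /(absval_eq0 hv)/eqP; rewrite oner_eq0.
by apply: (mulfI v1); rewrite -(absvalM hv) !mulr1.
Qed.

Lemma absvalX x n : v (x ^+ n) = v x ^+ n.
Proof. by elim: n => [|n ih]; rewrite ?absval1// !exprS (absvalM hv) ih. Qed.

Lemma absvalV x : v x^-1 = (v x)^-1.
Proof.
have [->|x0] := eqVneq x 0; first by rewrite invr0 absval0 invr0.
have vx : v x != 0 by apply: contra_neq x0 => /(absval_eq0 hv).
by apply: (mulfI vx); rewrite -(absvalM hv) !mulfV// absval1.
Qed.

Lemma absval_exprz x (n : int) : v (x ^ n) = v x ^ n.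
Proof.
by case: n => n; rewrite ?NegzE -?exprnP -?exprnN ?absvalV absvalX.
Qed.

Lemma absval_norm : ultrametric_norm v.
Proof.
split; [exact: absval0 | | exact: (absvalD hv)] => x.
have vN1 : v (- 1) = 1.
  have /eqP : v (- 1) ^+ 2 = 1 by rewrite -absvalX sqrrN expr1n absval1.
  by rewrite sqrp_eq1 ?(absval_ge0 hv)// => /eqP.
by rewrite -mulN1r (absvalM hv) vN1 mul1r.
Qed.
Let hu := absval_norm.

Lemma absval_natr n : v n%:R <= 1.
Proof.
elim: n => [|n ih]; first by rewrite absval0.
by rewrite -natr1 (ultra_leD hu) ?absval1.
Qed.

Lemma absval_leM1 x y c : v x <= c -> v y <= 1 -> v (x * y) <= c.
Proof.
move=> vx vy; rewrite (absvalM hv) (le_trans _ vx)//.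
by rewrite ler_piMr ?(absval_ge0 hv).
Qed.

Lemma absval_leX1 x n : v x <= 1 -> v (x ^+ n) <= 1.
Proof. by move=> vx; rewrite absvalX exprn_ile1 ?(absval_ge0 hv). Qed.

Lemma absval_subX x y n :
  v x <= 1 -> v y <= 1 -> v (x ^+ n - y ^+ n) <= v (x - y).
Proof.
move=> vx vy; rewrite subrXX absval_leM1//.
by apply: (ultra_le_sum hu) => // i _; rewrite absval_leM1 ?absval_leX1.
Qed.

(* [x ^+ n - y ^+ n = (x - y) * S] and [S] is [n y ^+ n.-1] modulo [x - y]. *)
Lemma absval_subX_contract x y n : v x <= 1 -> v y <= 1 ->
  v (x ^+ n - y ^+ n) <= Num.max (v n%:R) (v (x - y)) * v (x - y).
Proof.
move=> vx vy; rewrite subrXX (absvalM hv) mulrC ler_wpM2r ?(absval_ge0 hv)//.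
have -> : \sum_(i < n) x ^+ (n.-1 - i) * y ^+ i =
    n%:R * y ^+ n.-1 +
    \sum_(i < n) (x ^+ (n.-1 - i) - y ^+ (n.-1 - i)) * y ^+ i.
  rewrite mulr_natl -[in X in _ *+ X](card_ord n) -sumr_const -big_split/=.
  apply: eq_bigr => i _; rewrite mulrBl -exprD subnK.
    by rewrite addrC subrK.
  by rewrite -ltnS prednK ?(leq_ltn_trans _ (ltn_ord i)).
apply: (ultra_leD hu).
  by rewrite le_max absval_leM1 ?absval_leX1.
rewrite le_max; apply/orP; right.
apply: (ultra_le_sum hu) => [|i _]; first exact: absval_ge0.
by rewrite absval_leM1 ?absval_leX1 ?absval_subX.
Qed.

Lemma absval_root_le1 w n : (1 < n)%N -> w ^+ n = w -> v w <= 1.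
Proof.
move=> n1 wn; rewrite leNgt; apply/negP => vw.
by have := ltr_eXnr n vw; rewrite n1 -absvalX wn ltxx.
Qed.

(** Both roots lie in the unit ball, so their distance is at most 1. Were it smaller, the
    contraction estimate applied to [x - y = x ^+ n - y ^+ n] would make it strictly smaller than
    itself. *)
Lemma absval_sub_roots x y n : (1 < n)%N -> v n%:R < 1 ->
  x ^+ n = x -> y ^+ n = y -> x != y -> v (x - y) = 1.
Proof.
move=> n1 vn xn yn xy; have vx := absval_root_le1 n1 xn.
have vy := absval_root_le1 n1 yn.
apply/eqP; rewrite eq_le (ultra_leB hu)//= leNgt; apply/negP => vxy.
have vxy0 : 0 < v (x - y).
  rewrite lt_def (absval_ge0 hv) andbT -subr_eq0 in xy *.
  by apply: contra_neq xy => /(absval_eq0 hv).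
have := absval_subX_contract n vx vy; rewrite xn yn leNgt.
by rewrite gtr_pMl// gt_max vn vxy.
Qed.

(** The powers [a ^+ (p ^ n)] form a Cauchy sequence, because the [p]-th power map contracts
    distances of size at most [v p%:R] by that factor. Their limit is fixed by the map. *)
Lemma teichmuller_lift p a : norm_complete v -> (0 < p)%N -> v p%:R < 1 ->
  v a <= 1 -> v (a ^+ p - a) <= v p%:R ->
  exists w, w ^+ p = w /\ v (w - a) < 1.
Proof.
move=> complete p0 vp va vap.
pose u n := a ^+ (p ^ n); have uS n : u n.+1 = u n ^+ p.
  by rewrite /u expnSr exprM.
have vu n : v (u n) <= 1 by exact: absval_leX1.
have step n : v (u n.+1 - u n) <= v p%:R ^+ n.+1.
  elim: n => [|n ih]; first by rewrite uS /u expn0 expr1 expr1.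
  rewrite uS [in X in _ - X]uS.
  apply: (le_trans (absval_subX_contract _ (vu _) (vu _))).
  rewrite [in leRHS]exprS ler_pM ?(absval_ge0 hv)//.
    by rewrite le_max (absval_ge0 hv).
  rewrite ge_max lexx (le_trans ih)// exprS ler_piMr ?(absval_ge0 hv)//.
  by rewrite exprn_ile1 ?(absval_ge0 hv)// ltW.
(* Ultrametric telescoping: the total displacement is bounded by the largest, hence the first,
   step. *)
have steps m n : v (u (n + m)%N - u n) <= v p%:R ^+ n.+1.
  elim: m => [|m ih].
    by rewrite addn0 subrr absval0 exprn_ge0 ?(absval_ge0 hv).
  rewrite addnS -(subrK (u (n + m)%N) (u _)) -addrA (ultra_leD hu)//.
  rewrite (le_trans (step _))// ler_wiXn2l ?(absval_ge0 hv) ?ltnS ?leq_addr//.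
  exact: ltW.
have vp_cvg : (fun n => v p%:R ^+ n) @ \oo --> (0 : R).
  by apply: cvg_expr; rewrite ger0_norm ?(absval_ge0 hv).
have [w uw] : exists w, norm_cvg v u w.
  apply: complete => e e0.
  have /cvgrPdist_lt/(_ _ e0)[n0 _ hn0] := vp_cvg.
  have tail m : (n0 <= m)%N -> v (u m - u n0) < e.
    move=> /subnKC <-; rewrite (le_lt_trans (steps _ _))//.
    have := hn0 n0.+1 (leqnSn _); rewrite sub0r normrN ger0_norm//.
    by rewrite exprn_ge0 ?(absval_ge0 hv).
  exists n0 => m n hm hn; rewrite -(subrK (u n0) (u m)) -addrA.
  by rewrite (ultra_ltD hu) ?tail// (ultra_subC hu) tail.
have near_w e : 0 < e -> exists n, v (u n - w) < e /\ v (u n.+1 - w) < e.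
  move=> e0; have /cvgrPdist_lt/(_ _ e0)[n0 _ hn0] := uw.
  have hn n : (n0 <= n)%N -> v (u n - w) < e.
    move=> /hn0; rewrite sub0r normrN ger0_norm//; exact: absval_ge0.
  by exists n0; rewrite !hn.
have vwa : v (w - a) < 1.
  have [n [un _]] := near_w _ ltr01.
  rewrite -(subrK (u n) w) -addrA (ultra_ltD hu)//.
    by rewrite (ultra_subC hu).
  have := steps n 0; rewrite add0n expr1 /(u 0) expn0 expr1 => h.
  exact: le_lt_trans h vp.
have vw : v w <= 1 by rewrite -(subrK a w) (ultra_leD hu)// ltW.
(* Were [w ^+ p - w] nonzero, its own norm could serve as the tolerance: it is the sum of
   [w ^+ p - u n.+1] and [u n.+1 - w], both then strictly smaller than it. *)
exists w; split=> //; apply/eqP; rewrite -subr_eq0; apply/eqP/(absval_eq0 hv).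
apply/eqP; rewrite eq_le (absval_ge0 hv) andbT leNgt; apply/negP => /near_w.
move=> [n [un un1]].
suff : v (w ^+ p - w) < v (w ^+ p - w) by rewrite ltxx.
rewrite -[X in v X < _](subrKA (u n.+1)) (ultra_ltD hu)//.
by rewrite uS (le_lt_trans (absval_subX _ _ _))// (ultra_subC hu).
Qed.

End AbsoluteValue.

(** * Teichmüller representatives in the p-adic numbers *)

Section PadicTeichmuller.
Set Implicit Arguments.
Unset Strict Implicit.
Context {R : realType} {p : nat} {F : fieldType} {v : F -> R}.
Hypothesis hp : prime p.
Hypothesis hv : padic_numbers p v.
Let ha := padic_ultrametric hv.
Let hu := absval_norm ha.

Lemma padic_natr n : (0 < n)%N -> v n%:R = p%:R^-1 ^+ logn p n.
Proof.
move=> n0; rewrite -(ratr_nat F n) (padic_rat hv) /padic_absval.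
rewrite pnatr_eq0 eqn0Ngt n0 -[n%:R]/(n%:~R) numq_int denq_int.
by rewrite /= logn1 sub0r -exprnN exprVn.
Qed.

Lemma padic_natr_p : v p%:R = p%:R^-1.
Proof. by rewrite padic_natr ?prime_gt0// logn_prime// eqxx expr1. Qed.

Lemma padic_p_lt1 : v p%:R < 1.
Proof.
by rewrite padic_natr_p invf_lt1 ?ltr0n ?ltr1n ?prime_gt0 ?prime_gt1.
Qed.

(** Fermat's little theorem makes every [a < p] a root modulo [p], which lifts. Lifts of distinct
    [a < b] differ, since [b - a] is prime to [p] and so has norm 1. *)
Lemma padic_teichmuller :
  exists T : seq F, [/\ uniq T, size T = p & {in T, forall w, w ^+ p = w}].
Proof.
have lift (a : 'I_p) : exists w : F, w ^+ p = w /\ v (w - a%:R) < 1.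
  have := padic_is_complete hv.
  move=> /teichmuller_lift; apply; rewrite ?prime_gt0 ?padic_p_lt1//.
    exact: absval_natr.
  (* Makes the truncated subtraction of naturals in Fermat's congruence a genuine difference. *)
  have le_a : (a <= a ^ p)%N.
    have [->//|a0] := posnP (nat_of_ord a).
    by rewrite -{1}(expn1 a) leq_pexp2l// prime_gt0.
  have /eqP := fermat_little a hp; rewrite eqn_mod_dvd// => /dvdnP[q aq].
  by rewrite -natrX -natrB// aq natrM mulrC absval_leM1// absval_natr.
have [w hw] := choice lift.
have w_neq (a b : 'I_p) : (a < b)%N -> w a != w b.
  move=> ab; apply/eqP => wab; have [_ wb] := hw b; have [_ wa] := hw a.
  have : v (b%:R - a%:R) < 1.
    by rewrite -(subrKA (w b)) (ultra_ltD hu) -?wab// (ultra_subC hu) wab.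
  rewrite -natrB 1?ltnW// padic_natr ?subn_gt0// logn_coprime ?expr0 ?ltxx//.
  rewrite prime_coprime// gtnNdvd ?subn_gt0//.
  exact: leq_ltn_trans (leq_subr _ _) (ltn_ord b).
exists (codom w); split; last by move=> _ /codomP[a ->]; have [] := hw a.
  apply/injectiveP => a b wab; apply/val_inj/eqP/negPn/negP.
  by rewrite neq_ltn => /orP[] /w_neq; rewrite wab eqxx.
by rewrite size_codom card_ord.
Qed.

End PadicTeichmuller.

(** * Idempotents from Lagrange interpolation *)

Section LagrangeIdempotents.
Set Implicit Arguments.
Unset Strict Implicit.
Context {K : fieldType} {A : comAlgType K}.
Variable S : seq K.
Hypothesis uS : uniq S.

(** The Lagrange basis polynomial of the node [w], evaluated at [x]. *)
Definition lagrange_idem (x : A) (w : K) : A :=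
  \prod_(u <- S | u != w) ((w - u)^-1 *: (x - u%:A)).

Let lagrange_poly w := \prod_(u <- S | u != w) ((w - u)^-1 *: ('X - u%:P)).

Let horner_lagrange x w : horner_alg x (lagrange_poly w) = lagrange_idem x w.
Proof.
rewrite rmorph_prod; apply: eq_bigr => u _.
by rewrite [LHS]linearZ/= rmorphB/= horner_algX horner_algC mulr_algl.
Qed.

(** The basis polynomials sum to 1: the difference vanishes at all [size S] nodes and has smaller
    degree. The identity is then evaluated at [x]. *)
Lemma lagrange_idem_sum x :
  (0 < size S)%N -> \sum_(w <- S) lagrange_idem x w = 1.
Proof.
move=> S0; have : 1 = \sum_(w <- S) lagrange_poly w.
  apply/eqP; rewrite eq_sym -subr_eq0; apply/eqP.
  apply: (roots_geq_poly_eq0 (rs := S)) => //.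
    apply/allP => z zS; rewrite rootE hornerD hornerN hornerC horner_sum.
    rewrite (bigD1_seq z)//= [X in X + _ - 1 == 0]horner_prod.
    rewrite [X in X + _ - 1 == 0]big1 => [|u uz]; last first.
      by rewrite hornerZ hornerXsubC mulVf// subr_eq0 eq_sym.
    rewrite big1_seq ?addr0 ?subrr// => w /andP[wz wS].
    rewrite horner_prod; apply/eqP; rewrite prodf_seq_eq0.
    apply/hasP; exists z => //.
    by rewrite eq_sym wz hornerZ hornerXsubC subrr mulr0 eqxx.
  apply: leq_trans (size_polyD _ _) _; rewrite geq_max size_polyN size_poly1 S0.
  rewrite andbT; apply: leq_trans (size_sum _ _ _) _.
  apply/bigmax_leqP_seq => w wS _.
  rewrite /lagrange_poly -big_filter.
  have le_size (s : seq K) :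
      (size (\prod_(u <- s) ((w - u)^-1 *: ('X - u%:P)))%R <= (size s).+1)%N.
    elim: s => [|u s ih]; first by rewrite big_nil size_poly1.
    rewrite big_cons; apply: leq_trans (size_polyMleq _ _) _.
    rewrite -subn1 leq_subLR (leq_trans (leq_add (size_scale_leq _ _) ih))//.
    by rewrite size_XsubC.
  apply: leq_trans (le_size _) _.
  have -> : [seq u <- S | u != w] = rem w S by rewrite rem_filter.
  by rewrite size_rem// prednK.
move/(congr1 (horner_alg x)); rewrite rmorph1 rmorph_sum => ->.
by apply: eq_bigr => w _; apply/esym/horner_lagrange.
Qed.

Section AtRoot.
Variable x : A.
Hypothesis hx : x ^+ size S = x.
Hypothesis S1 : (1 < size S)%N.
Hypothesis hS : {in S, forall w, w ^+ size S = w}.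

(** The nodes are as many roots of ['X^(size S) - 'X] as its degree, so it splits over [S]; it also
    annihilates [x]. *)
Let prod_root : \prod_(w <- S) (x - w%:A) = 0.
Proof.
have size_p : size ('X^(size S) - 'X : {poly K}) = (size S).+1.
  by rewrite size_polyDl size_polyXn// size_polyN size_polyX.
have := all_roots_prod_XsubC size_p; rewrite lead_coefE size_p/=.
rewrite coefB coefXn coefX eqxx (gtn_eqF S1) subr0 scale1r uniq_rootsE.
move=> /(_ _ uS) pE.
have : 'X^(size S) - 'X = \prod_(w <- S) ('X - w%:P).
  by apply: pE; apply/allP => w /hS wq; rewrite rootE !hornerE wq subrr.
move/(congr1 (horner_alg x)); rewrite rmorphB rmorphXn/= horner_algX hx subrr.
move=> ->; rewrite rmorph_prod; apply: eq_bigr => w _.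
by rewrite rmorphB/= horner_algX horner_algC.
Qed.

(** Multiplying by [x - w%:A] restores the missing factor of the full product, which is zero. *)
Lemma lagrange_idem_eigen w :
  w \in S -> x * lagrange_idem x w = w *: lagrange_idem x w.
Proof.
move=> wS; apply/eqP; rewrite -subr_eq0 -mulr_algl -mulrBl; apply/eqP.
suff [c ->] : exists c : K,
    lagrange_idem x w = c *: \prod_(u <- S | u != w) (x - u%:A).
  rewrite -scalerAr; move: prod_root; rewrite (bigD1_seq w)//= => ->.
  by rewrite scaler0.
by rewrite /lagrange_idem scaler_prod; eexists.
Qed.

(** On the product, [x] acts both as [w] and as [u], and [w - u] is invertible. *)
Lemma lagrange_idem_orth w u : w \in S -> u \in S -> w != u ->
  lagrange_idem x w * lagrange_idem x u = 0.
Proof.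
move=> wS uS' wu; have : (w - u) *: (lagrange_idem x w * lagrange_idem x u) = 0.
  rewrite scalerBl scalerAl -lagrange_idem_eigen// scalerAr.
  rewrite -(lagrange_idem_eigen uS').
  by rewrite mulrA [_ * x]mulrC subrr.
move/(congr1 ( *:%R (w - u)^-1)); rewrite scaler0 scalerA mulVf ?scale1r//.
by rewrite subr_eq0.
Qed.

End AtRoot.
End LagrangeIdempotents.

(** * Multiplicative functionals given by words of digits *)

Section DigitFunctional.
Set Implicit Arguments.
Unset Strict Implicit.
Context {F : comNzRingType} {A : comNzRingType}.
Variables (T : seq F) (e : nat -> F -> A) (c : nat -> F).

(* [digit_sum n f] is the sum, over all words [w] of length [n] on [T], of
   [f (\sum_i w_i * c_i)] weighted by [\prod_i e i w_i]. *)
Fixpoint digit_sum (n : nat) (f : F -> A) : A :=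
  if n is m.+1 then
    \sum_(w <- T) e m w * digit_sum m (fun z => f (z + w * c m))
  else f 0.

(** The finite support of [digit_sum n], from which the finiteness of the sums over balls will
    follow. *)
Fixpoint digit_points (n : nat) : seq F :=
  if n is m.+1 then [seq z + w * c m | z <- digit_points m, w <- T]
  else [:: 0].

Lemma eq_digit_sum n f g :
  {in digit_points n, f =1 g} -> digit_sum n f = digit_sum n g.
Proof.
elim: n f g => [|n ih] f g fg /=; first by apply: fg; rewrite mem_head.
apply: eq_big_seq => w wT; congr (_ * _); apply: ih => z zn.
by apply: fg; apply/allpairsP; exists (z, w).
Qed.

Lemma digit_sumD n f g :
  digit_sum n (fun z => f z + g z) = digit_sum n f + digit_sum n g.
Proof.
elim: n f g => [//|n ih] f g /=; rewrite -big_split/=.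
by apply: eq_bigr => w _; rewrite ih mulrDr.
Qed.

Lemma digit_sumM n a f : digit_sum n (fun z => a * f z) = a * digit_sum n f.
Proof.
elim: n f => [//|n ih] f /=; rewrite mulr_sumr.
by apply: eq_bigr => w _; rewrite ih mulrCA.
Qed.

Lemma digit_sum0 n : digit_sum n (fun=> 0) = 0.
Proof. by elim: n => [//|n ih] /=; rewrite big1// => w _; rewrite ih mulr0. Qed.

Lemma digit_sum_sum n (I : Type) (s : seq I) (f : I -> F -> A) :
  digit_sum n (fun z => \sum_(i <- s) f i z) = \sum_(i <- s) digit_sum n (f i).
Proof.
elim: s => [|i s ih].
  rewrite big_nil -[RHS](digit_sum0 n).
  by apply: eq_digit_sum => z _; rewrite big_nil.
rewrite big_cons -ih -digit_sumD.
by apply: eq_digit_sum => z _; rewrite big_cons.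
Qed.

Hypothesis e_sum : forall n, \sum_(w <- T) e n w = 1.

Lemma digit_sum1 n : digit_sum n (fun=> 1) = 1.
Proof.
elim: n => [//|n ih] /=; rewrite ih -[RHS](e_sum n).
by apply: eq_bigr => w _; rewrite mulr1.
Qed.

Lemma digit_sum_cst n a : digit_sum n (fun=> a) = a.
Proof. by have := digit_sumM n a (fun=> 1); rewrite digit_sum1 mulr1. Qed.

Lemma digit_sumS n f : {in T, forall w z, f (z + w * c n) = f z} ->
  digit_sum n.+1 f = digit_sum n f.
Proof.
move=> fT /=; rewrite -[RHS]mul1r -(e_sum n) mulr_suml.
apply: eq_big_seq => w wT; congr (_ * _).
by apply: eq_digit_sum => z _; exact: fT.
Qed.

Hypothesis uT : uniq T.
Hypothesis e_orth : forall n,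
  {in T &, forall w u, w != u -> e n w * e n u = 0}.

Lemma digit_idem n : {in T, forall w, e n w * e n w = e n w}.
Proof.
move=> w wT; rewrite -[RHS]mulr1 -(e_sum n) (bigD1_seq w)//= mulrDr mulr_sumr.
rewrite [X in _ + X]big1_seq ?addr0// => u /andP[uw uT'].
by rewrite e_orth// eq_sym.
Qed.

(** Cross terms die by orthogonality and diagonal terms merge by idempotence. Indicators thus go to
    idempotents, and disjoint indicators to orthogonal ones. *)
Lemma digit_sum_mul n f g :
  digit_sum n (fun z => f z * g z) = digit_sum n f * digit_sum n g.
Proof.
elim: n f g => [//|n ih] f g /=; rewrite mulr_suml.
apply: eq_big_seq => w wT; rewrite ih mulr_sumr (bigD1_seq w)//=.
rewrite [X in _ + X]big1_seq => [|u /andP[uw uT']].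
  by rewrite addr0 mulrACA digit_idem.
by rewrite mulrACA e_orth ?mul0r// eq_sym.
Qed.

End DigitFunctional.

(** * Norm estimates in the Banach algebra *)

Section UltrametricAlgebra.
Set Implicit Arguments.
Unset Strict Implicit.
Context {R : realType} {K : fieldType} {nK : K -> R}.
Context {A : comAlgType K} {nA : A -> R}.
Hypothesis hK : ultrametric_absval nK.
Hypothesis hA : ultrametric_banach_algebra nK nA.

Lemma banach_norm : ultrametric_norm nA.
Proof.
split; [exact/(banach_eq0 hA) | | exact: (banachD hA)] => a.
by rewrite -scaleN1r (banachZ hA) (ultraN (absval_norm hK)) (absval1 hK) mul1r.
Qed.

Lemma banach_alg c : nA c%:A = nK c.
Proof. by rewrite (banachZ hA) (banach1 hA) mulr1. Qed.

Lemma banach_leM1 a b r : nA a <= 1 -> nA b <= r -> nA (a * b) <= r.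
Proof.
move=> a1 br; rewrite (le_trans (banachM hA _ _))// (le_trans _ br)//.
by rewrite ler_piMl// (banach_ge0 hA).
Qed.

(** For [a] nonzero, submultiplicativity on [a * a = a] forces [nA a >= 1]. *)
Lemma idempotent_norm a :
  a * a = a -> nA a <= 1 -> a = 0 \/ orthogonal_projection nA a.
Proof.
move=> aa a1; have [->|a0] := eqVneq a 0; [by left | right; split=> //].
have na0 : 0 < nA a.
  rewrite lt_def (banach_ge0 hA) andbT.
  by apply: contra_neq a0 => /(banach_eq0 hA).
apply/eqP; rewrite eq_le a1/= -(ler_pM2r na0) mul1r -{1}aa.
exact: (banachM hA).
Qed.

Lemma digit_sum_norm (F : comNzRingType) (T : seq F) e c n f r : 0 <= r ->
  (forall n, {in T, forall w, nA (e n w) <= 1}) ->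
  (forall z, nA (f z) <= r) -> nA (digit_sum T e c n f) <= r.
Proof.
move=> r0 e1; elim: n f => [|n ih] f fr /=; first exact: fr.
apply: (ultra_le_sum banach_norm) => // w wT.
by rewrite banach_leM1 ?e1// ih.
Qed.

(** Since the nodes are at mutual distance 1, the denominators have norm 1 and every factor stays in
    the unit ball. *)
Lemma lagrange_idem_norm (S : seq K) (x : A) w : w \in S -> nA x <= 1 ->
  {in S, forall u, nK u <= 1} ->
  {in S &, forall u v, u != v -> nK (u - v) = 1} ->
  nA (lagrange_idem S x w) <= 1.
Proof.
move=> wS x1 S1 SS; rewrite /lagrange_idem big_seq_cond.
elim/big_rec: _ => [|u a /andP[uS uw] a1]; first by rewrite (banach1 hA).
rewrite banach_leM1// (banachZ hA) (absvalV hK) SS 1?eq_sym// invr1 mul1r.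
by rewrite (ultra_leB banach_norm)// banach_alg S1.
Qed.

End UltrametricAlgebra.

(** * Balls and the Boolean algebra they generate *)

Section Balls.
Set Implicit Arguments.
Unset Strict Implicit.
Context {R : realType} (p : nat) {F : fieldType} (nF : F -> R).
Hypothesis hp : (1 < p)%N.
Hypothesis hF : ultrametric_absval nF.
Let hu := absval_norm hF.

(** Says that [U] is a union of balls of radius [p ^ (- m)]; one implication suffices because the
    distance is symmetric. *)
Definition ball_invariant (m : int) (U : set F) : Prop :=
  forall x y, nF (x - y) <= (p%:R : R) ^ (- m) -> U x -> U y.

Lemma pball_center m c : pball p nF m c c.
Proof.
by rewrite /pball/= subrr (absval0 hF) exprz_ge0 ?ler0n.
Qed.

Lemma pball_invariant m c : ball_invariant m (pball p nF m c).
Proof.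
move=> x y xy; rewrite /pball/= => xc; rewrite -(subrKA x) (ultra_leD hu)//.
by rewrite (ultra_subC hu).
Qed.

Lemma pball_eq m c z : pball p nF m c z -> pball p nF m c = pball p nF m z.
Proof.
rewrite /pball/= => cz; apply/seteqP; split=> y /= yB.
  by rewrite -(subrKA c) (ultra_leD hu)// (ultra_subC hu).
by rewrite -(subrKA z) (ultra_leD hu).
Qed.

Lemma ball_invariant_le m n U :
  m <= n -> ball_invariant m U -> ball_invariant n U.
Proof.
move=> mn hU x y xy; apply: hU; apply: le_trans xy _.
by rewrite ler_weXz2l ?lerN2// ler1n ltnW.
Qed.

(** The sets invariant at some level form an algebra containing the balls; a union takes the finer
    of the two levels. *)
Lemma ball_algebra_invariant U :
  ball_algebra p nF U -> exists m, ball_invariant m U.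
Proof.
move: U; apply: smallest_sub; last first.
  by move=> _ [m _ [c _ <-]]; exists m; exact: pball_invariant.
split=> [|U [m hU]|U V [m hU] [n hV]].
- by exists 0 => x y _.
- exists m => x y xy Ux Uy; apply/Ux/(hU y) => //.
  by rewrite (ultra_subC hu).
exists (Num.max m n) => x y xy [Ux|Vx]; [left|right].
  by apply: (ball_invariant_le _ hU xy Ux); rewrite le_max lexx.
by apply: (ball_invariant_le _ hV xy Vx); rewrite le_max lexx orbT.
Qed.

End Balls.

(** * The spectral measure of a sequence of digit idempotents *)

Section DigitSpectralMeasure.
Set Implicit Arguments.
Unset Strict Implicit.
Context {R : realType} {p : nat} {F : fieldType} {nF : F -> R}.
Context {K : fieldType} {nK : K -> R} {A : comAlgType K} {nA : A -> R}.
Hypothesis hp : (1 < p)%N.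
Hypothesis hF : ultrametric_absval nF.
Hypothesis nFp : nF p%:R = p%:R^-1.
Hypothesis hK : ultrametric_absval nK.
Hypothesis hA : ultrametric_banach_algebra nK nA.
Variable j : {rmorphism F -> K}.
Hypothesis hj : forall y, nK (j y) = nF y.
Variables (k : int) (T : seq F) (e : nat -> F -> A).
Hypothesis uT : uniq T.
Hypothesis T1 : {in T, forall w, nF w <= 1}.
Hypothesis e_sum : forall n, \sum_(w <- T) e n w = 1.
Hypothesis e_orth : forall n,
  {in T &, forall w u, w != u -> e n w * e n u = 0}.
Hypothesis e_norm : forall n, {in T, forall w, nA (e n w) <= 1}.

Let scale (n : nat) : F := p%:R ^ (k + n%:Z).
Let M := digit_sum T e scale.

Definition level_measure (n : nat) (U : set F) : A := M n (\1_U).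

(* The sequence is eventually constant on the ball algebra; elsewhere the
   value is arbitrary. *)
Definition digit_measure (U : set F) : A :=
  xget 0 [set a | \forall n \near \oo, level_measure n U = a].

(** The next digit moves a point by at most [p ^ (- m)], which cannot change membership in [U]. *)
Lemma level_measureS m n U : ball_invariant p nF m U -> m <= k + n%:Z ->
  level_measure n.+1 U = level_measure n U.
Proof.
move=> hU mn; apply: (digit_sumS e_sum) => w wT z.
have small : nF (w * scale n) <= p%:R ^ (- m).
  rewrite mulrC (absval_leM1 hF) ?T1// (absval_exprz hF) nFp exprz_inv.
  by rewrite ler_weXz2l ?lerN2// ler1n ltnW.
rewrite !indicE; congr (_%:R); congr nat_of_bool.
apply/idP/idP; rewrite !inE; apply: hU.
  by rewrite addrAC subrr add0r.
by rewrite opprD addNKr (ultraN (absval_norm hF)).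
Qed.

Lemma digit_measureE m n U : ball_invariant p nF m U -> m <= k + n%:Z ->
  digit_measure U = level_measure n U.
Proof.
move=> hU mn; rewrite /digit_measure.
have stable i : level_measure (n + i) U = level_measure n U.
  elim: i => [|i ih]; first by rewrite addn0.
  rewrite addnS (level_measureS hU) ?ih//.
  by rewrite (le_trans mn)// lerD2l lez_nat leq_addr.
have near_stable : \forall i \near \oo, level_measure i U = level_measure n U.
  by exists n => // i /= /subnKC <-.
(* Two eventual values agree at a common index, so the chosen one is the stable one; the default
   case is excluded by [near_stable]. *)
case: xgetP => [a _ /= near_a|/(_ (level_measure n U))//].
by have [i [<- ->]] := filter_ex (filterI near_a near_stable).
Qed.

Lemma digit_measure_near U : ball_algebra p nF U ->
  \forall n \near \oo, digit_measure U = level_measure n U.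
Proof.
move=> /(ball_algebra_invariant hp hF)[m hU].
exists `|m - k|%N => // n /= mn; apply: (digit_measureE hU).
by rewrite -lerBlDl (le_trans (lez_abs _))// lez_nat.
Qed.

(** At a level valid for all the sets involved, each clause reduces to a pointwise identity between
    indicators. *)
Lemma digit_measure_spectral : spectral_measure p nF nA digit_measure.
Proof.
split=> [U aU|U V aU aV UV0|U V aU aV UV0].
- have [n ->] := filter_ex (digit_measure_near aU).
  apply: (idempotent_norm hA).
    rewrite -(digit_sum_mul scale e_sum uT e_orth); apply: eq_digit_sum => z _.
    by rewrite indicE -natrM mulnb andbb.
  apply: (digit_sum_norm hK hA) => // z; rewrite indicE.
  by case: (z \in U); rewrite ?(banach1 hA) ?(ultra0 (banach_norm hK hA)).
- have aUV : ball_algebra p nF (U `|` V).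
    by move=> G [hG ballsG]; have [_ _] := hG; apply; [apply: aU|apply: aV].
  near \oo => n.
  rewrite (near (digit_measure_near aUV) n)//.
  rewrite (near (digit_measure_near aU) n)//.
  rewrite (near (digit_measure_near aV) n)// -digit_sumD.
  apply: eq_digit_sum => z _; rewrite !indicE in_setU -natrD; congr _%:R.
  have : ~~ ((z \in U) && (z \in V)) by rewrite -in_setI UV0 in_set0.
  by case: (z \in U); case: (z \in V).
near \oo => n.
rewrite (near (digit_measure_near aU) n)// (near (digit_measure_near aV) n)//.
rewrite -(digit_sum_mul scale e_sum uT e_orth) -[RHS](digit_sum0 T e scale n).
apply: eq_digit_sum => z _.
by rewrite !indicE -natrM mulnb -in_setI UV0 in_set0.
Unshelve. all: by end_near.
Qed.

(** The balls that meet the support; [undup] because several digit points may share a ball. *)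
Let level_balls (m : int) (n : nat) : seq (set F) :=
  undup [seq pball p nF m z | z <- digit_points T scale n].

Let level_balls_sub m n : [set` level_balls m n] `<=` pballs p nF m.
Proof.
by move=> B /=; rewrite mem_undup => /mapP[z _ ->]; exists z.
Qed.

Let pball_unique m B z : pballs p nF m B -> B z -> B = pball p nF m z.
Proof. by move=> [c _ <-] /(pball_eq hF). Qed.

Let digit_measure_out m n B : m <= k + n%:Z -> pballs p nF m B ->
  B \notin level_balls m n -> digit_measure B = 0.
Proof.
move=> mn hB nB; have invB : ball_invariant p nF m B.
  by have [c _ <-] := hB; exact: pball_invariant.
rewrite (digit_measureE invB mn) -[RHS](digit_sum0 T e scale n).
apply: eq_digit_sum => z zn; rewrite indicE.
case: (boolP (z \in B)) => //; rewrite inE => /(pball_unique hB) Bz.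
by case/negP: nB; rewrite mem_undup Bz map_f.
Qed.

Lemma digit_measure_finite : finitely_many_balls p nF digit_measure.
Proof.
move=> m; have [n mn] : exists n : nat, m <= k + n%:Z.
  by exists `|m - k|%N; rewrite -lerBlDl lez_abs.
apply: (@sub_finite_set _ _ [set` level_balls m n]); last exact: finite_seq.
move=> B /= [hB EB]; apply: contra_neqT EB; exact: digit_measure_out.
Qed.

(* Each point lies in exactly one ball of level [m], so the sum over balls is
   the functional applied to a function constant on them. *)
Lemma digit_measure_sum (phi : set F -> K) m n : m <= k + n%:Z ->
  \sum_(B \in pballs p nF m) phi B *: digit_measure B =
  M n (fun z => (phi (pball p nF m z))%:A).
Proof.
move=> mn; rewrite -(fsbig_widen [set` level_balls m n]).
- rewrite -fsbig_seq ?undup_uniq//.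
  have -> : \sum_(B <- level_balls m n) phi B *: digit_measure B =
      \sum_(B <- level_balls m n) M n (fun z => (phi B)%:A * \1_B z).
    apply: eq_big_seq => B /level_balls_sub [c _ <-].
    rewrite /M digit_sumM mulr_algl.
    by rewrite (digit_measureE (pball_invariant hF (m := m) (c := c)) mn).
  rewrite -digit_sum_sum; apply: eq_digit_sum => z zn.
  rewrite (bigD1_seq (pball p nF m z)) ?undup_uniq//=; last first.
    by rewrite mem_undup map_f.
  rewrite big1_seq => [|B /andP[Bz /level_balls_sub hB]].
    by rewrite addr0 indicE mem_set ?mulr1//; apply: pball_center.
  rewrite indicE; case: (boolP (z \in B)) => [|_]; last by rewrite mulr0.
  by rewrite inE => /(pball_unique hB) BE; rewrite BE eqxx in Bz.
- exact: level_balls_sub.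
move=> B [hB /negP nB] /=.
by rewrite (digit_measure_out mn hB nB) scaler0.
Qed.

Lemma digit_measure_one : spectral_integral_one p nF digit_measure 1.
Proof.
split=> [|m]; first exact: digit_measure_finite.
have [n mn] : exists n : nat, m <= k + n%:Z.
  by exists `|m - k|%N; rewrite -lerBlDl lez_abs.
transitivity (\sum_(B \in pballs p nF m) (1 : K) *: digit_measure B).
  by apply: eq_fsbigr => B _; rewrite scale1r.
by rewrite (digit_measure_sum (fun=> 1) mn) scale1r /M (digit_sum1 scale e_sum).
Qed.

(** The last digit contributes a term constant for the inner functional, while the rest is
    multiplied by the sum of the [e n w], which is 1. *)
Lemma digit_sum_id n :
  M n (fun z => (j z)%:A) =
  \sum_(0 <= i < n) (p%:R : K) ^ (k + i%:Z) *: \sum_(w <- T) j w *: e i w.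
Proof.
elim: n => [|n ih]; first by rewrite big_nil /M/= rmorph0 scale0r.
rewrite big_nat_recr//= -ih scaler_sumr.
rewrite -[X in X + _]mul1r -[X in X * _ + _](e_sum n) mulr_suml -big_split/=.
apply: eq_bigr => w _; rewrite scalerA -mulr_algr -mulrDr; congr (_ * _).
rewrite -[X in _ + X](digit_sum_cst scale e_sum n) -digit_sumD.
apply: eq_digit_sum => z _.
by rewrite rmorphD rmorphM fmorphXz rmorph_nat scalerDl [j w * _]mulrC.
Qed.

(** A Riemann sum and a partial digit expansion are the same functional at two functions that differ
    by at most the ball radius. *)
Lemma digit_measure_id x :
  norm_cvg nA (fun n => \sum_(0 <= i < n)
    (p%:R : K) ^ (k + i%:Z) *: \sum_(w <- T) j w *: e i w) x ->
  spectral_integral_id p nF nA j digit_measure x.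
Proof.
move=> hx; split=> [|lam hlam]; first exact: digit_measure_finite.
(* The shift by [|k|] compensates a negative starting exponent, so that the digits used resolve
   balls of level [m]. *)
pose level m := (m + `|k|)%N.
have level_ge (m : nat) : m%:Z <= k + (level m)%:Z.
  by rewrite /level PoszD addrCA lerDl -lerBlDl sub0r -abszN lez_abs.
have hu := banach_norm hK hA.
pose err n := nA (M n (fun z => (j z)%:A) - x).
have err_cvg : (fun m => err (level m)) @ \oo --> (0 : R).
  rewrite /level cvg_shiftn.
  have -> : err = fun n => nA (\sum_(0 <= i < n)
      (p%:R : K) ^ (k + i%:Z) *: \sum_(w <- T) j w *: e i w - x).
    by apply/funext => n; rewrite /err digit_sum_id.
  exact: hx.
have rad_cvg : (fun m => (p%:R : R)^-1 ^+ m) @ \oo --> (0 : R).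
  apply: cvg_expr; rewrite ger0_norm ?invr_ge0 ?ler0n//.
  by rewrite invf_lt1 ?ltr0n ?ltr1n// ltnW.
have bound m :
    nA (\sum_(B \in pballs p nF m%:Z) j (lam m B) *: digit_measure B - x) <=
    p%:R^-1 ^+ m + err (level m).
  rewrite (digit_measure_sum (fun B => j (lam m B)) (level_ge m)).
  (* Passes through the partial expansion at [level m]; the ultrametric maximum is relaxed to a sum,
     whose limit is immediate. *)
  rewrite -(subrKA (M (level m) (fun z => (j z)%:A))) (ultra_leD hu)//.
    apply: ler_wpDr; first exact: (banach_ge0 hA).
    rewrite -mulN1r -digit_sumM -digit_sumD.
    apply: (digit_sum_norm hK hA) => // z.
    rewrite mulN1r -scalerBl (banach_alg hA) -rmorphB hj.
    have := hlam m (pball p nF m%:Z z) (ex_intro2 _ _ z I erefl).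
    by rewrite /pball/= -exprnN exprVn.
  by rewrite lerDr exprn_ge0// invr_ge0 ler0n.
apply: (squeeze_cvgr _ (cvg_cst (0 : R))).
  2: by rewrite -[X in _ --> X](addr0 0); exact: (cvgD rad_cvg err_cvg).
by apply: nearW => m /=; rewrite (banach_ge0 hA) bound.
Qed.

End DigitSpectralMeasure.

(** * Application to Hermite operators *)

(** Keeping the field [F] of the measure apart from the scalar field [K] lets one argument cover
    both the p-adic numbers and [K] itself. *)
Lemma hermite_spectral (R : realType) (p N : nat) (F : fieldType) (nF : F -> R)
    (K : fieldType) (nK : K -> R) (A : comAlgType K) (nA : A -> R)
    (j : {rmorphism F -> K}) (T : seq F) (x : A) :
  prime p -> (0 < N)%N ->
  ultrametric_absval nF -> nF p%:R = p%:R^-1 ->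
  ultrametric_absval nK -> (forall y, nK (j y) = nF y) ->
  ultrametric_banach_algebra nK nA ->
  uniq T -> size T = (p ^ N)%N -> {in T, forall w, w ^+ (p ^ N) = w} ->
  padic_hermite p nA N x ->
  exists E : set F -> A,
    [/\ spectral_measure p nF nA E,
        spectral_integral_one p nF E 1 &
        spectral_integral_id p nF nA j E x].
Proof.
move=> hp N0 hF nFp hK hj hA uT sT hT [k [xs [hxs hx]]].
have p1 := prime_gt1 hp.
have q1 : (1 < p ^ N)%N by rewrite -(exp1n N) ltn_exp2r.
have q_lt1 : nF (p ^ N)%:R < 1.
  rewrite natrX (absvalX hF) nFp exprn_ilt1 ?invr_ge0 ?ler0n -?lt0n//.
  by rewrite invf_lt1 ?ltr0n ?ltr1n ?prime_gt0.
(* Interpolation takes place in [K], the scalar field of [A], so the roots are transported there. *)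
pose S := map j T.
have uS : uniq S by rewrite map_inj_uniq//; exact: fmorph_inj.
have sS : size S = (p ^ N)%N by rewrite size_map.
have hS : {in S, forall w, w ^+ size S = w}.
  by move=> _ /mapP[w /hT wN ->]; rewrite sS -rmorphXn wN.
have T1 : {in T, forall w, nF w <= 1}.
  by move=> w /hT; exact: (absval_root_le1 hF).
have S1 : {in S, forall u, nK u <= 1}.
  by move=> _ /mapP[w wT ->]; rewrite hj T1.
have SS : {in S &, forall u v, u != v -> nK (u - v) = 1}.
  move=> _ _ /mapP[u uT' ->] /mapP[v vT ->] uv; rewrite -rmorphB hj.
  apply: (absval_sub_roots hF q1 q_lt1); rewrite ?hT//.
  by apply: contra_neq uv => ->.
pose X (n : nat) := xs (k + n%:Z).
have hX n : nA (X n) <= 1 /\ X n ^+ size S = X n.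
  by rewrite sS; apply: hxs; rewrite lerDl.
pose e (n : nat) (w : F) : A := lagrange_idem S (X n) (j w).
have e_sum n : \sum_(w <- T) e n w = 1.
  have := lagrange_idem_sum uS (X n).
  by rewrite sS (ltnW q1) big_map => ->.
have e_orth n : {in T &, forall w u, w != u -> e n w * e n u = 0}.
  move=> w u wT uT' wu; apply: (lagrange_idem_orth uS (proj2 (hX n))) => //.
  - by rewrite sS.
  - exact: map_f.
  - exact: map_f.
  by apply: contra_neq wu => /fmorph_inj.
have e_norm n : {in T, forall w, nA (e n w) <= 1}.
  move=> w wT; apply: (lagrange_idem_norm hK hA) => //; first exact: map_f.
  exact: (proj1 (hX n)).
(* Spectral decomposition of a digit: multiply the partition of unity by [X n] and use the
   eigenvalue relation. *)
have e_id n : \sum_(w <- T) j w *: e n w = X n.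
  rewrite -[RHS]mulr1 -(e_sum n) mulr_sumr; apply: eq_big_seq => w wT.
  rewrite (lagrange_idem_eigen uS (proj2 (hX n)))// ?sS//; exact: map_f.
exists (digit_measure (p := p) k T e); split.
- exact: (digit_measure_spectral p1 hF nFp hK hA).
- exact: (digit_measure_one p1 hF nFp).
apply: (digit_measure_id p1 hF nFp hK hA) => //.
have -> : (fun n => \sum_(0 <= i < n)
    (p%:R : K) ^ (k + i%:Z) *: \sum_(w <- T) j w *: e i w) =
  fun n => \sum_(0 <= i < n) (p%:R : K) ^ (k + i%:Z) *: xs (k + i%:Z).
  by apply/funext => n; apply: eq_bigr => i _; rewrite e_id.
exact: hx.
Qed.

Theorem theorem1p5 (R : realType) (p N : nat) (hp : prime p) (hN : (1 <= N)%N)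
    (Qp : fieldType) (nQ : Qp -> R) (hQp : padic_numbers p nQ)
    (K : fieldType) (nK : K -> R) (iota : {rmorphism Qp -> K})
    (hK : unramified_extension nQ nK iota)
    (hroots : [set w : K | w ^+ (p ^ N) = w] #= `I_(p ^ N))
    (A : comAlgType K) (nA : A -> R)
    (hA : ultrametric_banach_algebra nK nA)
    (hAK : range nA = range nK) :
  (forall x : A, padic_hermite p nA 1 x ->
     exists E : set Qp -> A,
       [/\ spectral_measure p nQ nA E,
           spectral_integral_one p nQ E 1 &
           spectral_integral_id p nQ nA iota E x]) /\
  (forall x : A, padic_hermite p nA N x ->
     exists E : set K -> A,
       [/\ spectral_measure p nK nA E,
           spectral_integral_one p nK E 1 &
           spectral_integral_id p nK nA (fun l : K => l) E x]).
Proof.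
have hQ := padic_ultrametric hQp; have nQp := padic_natr_p hp hQp.
have hk := unram_ultrametric hK.
split=> x hx.
  (* For period 1 the roots already lie in [Qp], by Teichmüller lifting. *)
  have [T [uT sT hT]] := padic_teichmuller hp hQp.
  have extends := unram_extends hK.
  by apply: (hermite_spectral hp (ltn0Sn 0) hQ nQp hk extends hA uT) hx.
have nKp : nK p%:R = p%:R^-1 by rewrite -nQp -(unram_extends hK) rmorph_nat.
have fin : finite_set [set w : K | w ^+ (p ^ N) = w].
  by apply/finite_setP; exists (p ^ N)%N.
(* For period [N] the measure lives on [K] with the identity embedding, and [hroots] supplies
   exactly [p ^ N] roots. *)
pose T := finmap.enum_fset (fset_set [set w : K | w ^+ (p ^ N) = w]).
apply: (hermite_spectral (j := idfun) (T := T) hp hN hk nKp hk _ hA) hx => //.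
- exact: finmap.fset_uniq.
- by rewrite -(card_fset_set hroots).
by move=> w; rewrite (in_fset_set fin) inE.
Qed.
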